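(* Let $X$ be an Archimedean ordered vector space with a generating cone (i.e. $X=X_+-X_+$), and let $Y$ be an arbitrary ordered vector space. Then every collectively o-continuous set ${\cal T}\subseteq{\cal L}(X,Y)$ of linear operators is collectively order bounded.
   Context: All vector spaces are real and operators are linear; ${\cal L}(X,Y)$ is the space of all linear operators from $X$ to $Y$. An ordered vector space $X$ has positive cone $X_+$ (with $X_+\cap(-X_+)=\{0\}$); order intervals are $[a,b]=\{x: a\le x\le b\}$. $X$ is Archimedean if $nx\le y$ for all $n\in\mathbb{N}$ implies $x\le 0$. The notation $g_\beta\downarrow 0$ means a decreasing net with infimum $0$. Order convergence: a net $(x_\alpha)$ in $X$ o-converges to $x$ if there is a net $g_\beta\downarrow 0$ in $X$ (possibly over a different index set) such that for each $\beta$ there is $\alpha_\beta$ with $-g_\beta\le x_\alpha-x\le g_\beta$ for all $\alpha\ge\alpha_\beta$. Collective o-convergence: a family ${\cal B}=\{(x^b_\alpha)_{\alpha\in A}\}_{b\in B}$ of nets indexed by the same directed set $A$ collectively o-converges to $0$ if there is a net $g_\beta\downarrow 0$ such that for each $\beta$ there is $\alpha_\beta$ with $\pm x^b_\alpha\le g_\beta$ for all $\alpha\ge\alpha_\beta$ and all $b\in B$. A set ${\cal T}\subseteq{\cal L}(X,Y)$ is collectively o-continuous if, whenever a net $(x_\alpha)$ o-converges to $0$ in $X$, the family $\{(Tx_\alpha)_\alpha\}_{T\in{\cal T}}$ collectively o-converges to $0$ in $Y$. A set ${\cal T}$ is collectively order bounded if for every order interval $[a,b]$ in $X$ there is an order interval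 $[u,v]$ in $Y$ with $\bigcup_{T\in{\cal T}}T[a,b]\subseteq[u,v]$. *)

(* Defs.v *)
From HB Require Import structures.
From mathcomp Require Import all_boot all_order all_algebra.
From mathcomp Require Import all_classical all_reals.

Set Implicit Arguments.
Unset Strict Implicit.
Unset Printing Implicit Defensive.

Import Order.TTheory GRing.Theory Num.Theory.
Local Open Scope classical_set_scope.
Local Open Scope ring_scope.

(* [porderZmodType] carries an order and an addition with no compatibility
   between them, hence the two axioms.  The positive cone is [set x | 0 <= x];
   antisymmetry of the order is the condition X_+ `&` (- X_+) = [set 0]. *)
HB.mixin Record isOrderedVectorSpace (R : numDomainType) V
    of Num.POrderedZmodule V & GRing.Lmodule R V := {
  ovs_leD2r : forall z x y : V, x <= y -> x + z <= y + z;
  ovs_leZ : forall (a : R) (x y : V), 0 <= a -> x <= y -> a *: x <= a *: y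
}.

#[short(type="ovsType")]
HB.structure Definition OrderedVectorSpace (R : numDomainType) :=
  {V of isOrderedVectorSpace R V & Num.POrderedZmodule V & GRing.Lmodule R V}.

(* Antisymmetry is not required of the order on the index set of a net. *)
HB.mixin Record isDirected (d : Order.disp_t) A of Order.Preorder d A := {
  directed_inhabited : inhabited A;
  directed_ub : forall a b : A, exists c : A, (a <= c)%O /\ (b <= c)%O
}.

#[short(type="directedType")]
HB.structure Definition Directed (d : Order.disp_t) :=
  {A of isDirected d A & Order.Preorder d A}.

Section OrderedVectorSpaces.
Context {R : numDomainType}.
Implicit Types X Y : ovsType R.

(* Here n = 0 is allowed.  Quantifying over n >= 1 instead gives the same
   notion: if n x <= y for all n >= 1, then n x <= y - x for all n >= 0. *)
Definition archimedean X : Prop :=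
  forall x y : X, (forall n : nat, x *+ n <= y) -> x <= 0.

Definition generating_cone X : Prop :=
  forall x : X, exists y z : X, [/\ 0 <= y, 0 <= z & x = y - z].

Definition decreases_to0 X d (B : directedType d) (g : B -> X) : Prop :=
  (forall b c : B, (b <= c)%O -> g c <= g b) /\ infimums (range g) 0.

Definition o_converges X d (A : directedType d) (x : A -> X) (l : X) : Prop :=
  exists (d' : Order.disp_t) (B : directedType d') (g : B -> X),
    decreases_to0 g /\
    forall b : B, exists a0 : A, forall a : A, (a0 <= a)%O ->
      - g b <= x a - l <= g b.

Definition collectively_o_converges0 X d (A : directedType d)
    (I : Type) (D : set I) (x : I -> A -> X) : Prop :=
  exists (d' : Order.disp_t) (B : directedType d') (g : B -> X),
    decreases_to0 g /\
    forall b : B, exists a0 : A, forall a : A, (a0 <= a)%O ->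
      forall i : I, D i -> x i a <= g b /\ - x i a <= g b.

Definition collectively_o_continuous X Y (T : set {linear X -> Y}) : Prop :=
  forall (d : Order.disp_t) (A : directedType d) (x : A -> X),
    o_converges x 0 ->
    collectively_o_converges0 T (fun (S : {linear X -> Y}) a => S (x a)).

Definition collectively_order_bounded X Y (T : set {linear X -> Y}) : Prop :=
  forall a b : X, exists u v : Y,
    \bigcup_(S in T) (S @` `[a, b]) `<=` `[u, v].

End OrderedVectorSpaces.

Arguments archimedean {R} X.
Arguments generating_cone {R} X.

(* Main.v *)
(* Scale the order interval down: the net y/(n+1), indexed by all pairs (n, y)
   with y in [a, b] and ordered by n alone, o-converges to 0.  A single tail of
   its image already contains T(y)/(n+1) for one fixed n and all y in [a, b]
   and all T at once, so a dominating element g gives the bound (n+1)g. *)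
Require Import Defs.
From HB Require Import structures.
From mathcomp Require Import all_boot all_order all_algebra.
From mathcomp Require Import all_classical all_reals.

Set Implicit Arguments.
Unset Strict Implicit.
Unset Printing Implicit Defensive.

Import Order.TTheory GRing.Theory Num.Theory.
Local Open Scope classical_set_scope.
Local Open Scope ring_scope.

(* The argument [i0] only records that [I] is inhabited. *)
Definition ranked (I : choiceType) (i0 : I) : Type := (nat * I)%type.

Section Ranked.
Context (I : choiceType) (i0 : I).

HB.instance Definition _ := Choice.on (ranked i0).

(** Ties between different second components are intended: each tail contains, at a fixed first
    component, every element of [I]. *)
Definition ranked_le (p q : ranked i0) : bool := (p.1 <= q.1)%N.

Fact ranked_le_refl : reflexive ranked_le.
Proof. by move=> p; exact: leqnn. Qed.

Fact ranked_le_trans : transitive ranked_le.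
Proof. by move=> q p r; exact: leq_trans. Qed.

HB.instance Definition _ := Order.Le_isPreorder.Build Order.default_display
  (ranked i0) ranked_le_refl ranked_le_trans.

Fact ranked_inhabited : inhabited (ranked i0).
Proof. exact: inhabits (0%N, i0). Qed.

Fact ranked_ub (p q : ranked i0) :
  exists r : ranked i0, (p <= r)%O /\ (q <= r)%O.
Proof.
exists (maxn p.1 q.1, i0).
by split; [exact: leq_maxl | exact: leq_maxr].
Qed.

HB.instance Definition _ := isDirected.Build Order.default_display
  (ranked i0) ranked_inhabited ranked_ub.

End Ranked.

Section OrderedVectorSpaceTheory.
Context {R : realType}.
Implicit Types X : ovsType R.

Lemma ovs_subr_ge0 X (x y : X) : (0 <= y - x) = (x <= y).
Proof.
apply/idP/idP => [/(ovs_leD2r x)|/(ovs_leD2r (- x))].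
  by rewrite add0r subrK.
by rewrite subrr.
Qed.

Lemma ovs_leN2 X (x y : X) : (- x <= - y) = (y <= x).
Proof. by rewrite -(ovs_subr_ge0 (- x)) opprK addrC ovs_subr_ge0. Qed.

Lemma ovs_leD X (x y z t : X) : x <= y -> z <= t -> x + z <= y + t.
Proof.
move=> /(ovs_leD2r z) xy /(ovs_leD2r y) zt.
by apply: le_trans xy _; rewrite addrC [y + t]addrC.
Qed.

Lemma ovs_scale_ge0 X (c : R) (x : X) : 0 <= c -> 0 <= x -> 0 <= c *: x.
Proof. by move=> c0 /(ovs_leZ _ _ _ c0); rewrite scaler0. Qed.

(** With [x = p - q] and [y = r - s] split into positive elements, [p + r] dominates both. *)
Lemma generating_cone_ub X : generating_cone X ->
  forall x y : X, exists e : X, [/\ 0 <= e, x <= e & y <= e].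
Proof.
move=> gX x y.
have [p [q [p0 q0 ->]]] := gX x; have [r [s [r0 s0 ->]]] := gX y.
have le_diff (u v : X) : 0 <= v -> u - v <= u.
  by move=> v0; rewrite -ovs_subr_ge0 opprB addrC subrK.
exists (p + r); split.
- by rewrite -[leLHS]addr0; exact: ovs_leD.
- by apply: le_trans (le_diff _ _ q0) _; rewrite -[leLHS]addr0; exact: ovs_leD.
- by apply: le_trans (le_diff _ _ s0) _; rewrite -[leLHS]add0r; exact: ovs_leD.
Qed.

(** A lower bound [z] of all [e / (n+1)] satisfies [(n+1) z <= e] for every [n], so the Archimedean
    property forces [z <= 0]. *)
Lemma archimedean_decreases_to0 X (e : X) (I : choiceType) (i0 : I) :
  archimedean X -> 0 <= e ->
  decreases_to0 (fun p : ranked i0 => p.1.+1%:R^-1 *: e).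
Proof.
move=> aX e0; split=> [p q pq|].
  rewrite -ovs_subr_ge0 -scalerBl; apply: ovs_scale_ge0 => //.
  by rewrite subr_ge0 lef_pV2 ?posrE ?ltr0n// ler_nat ltnS.
split=> [_ [p _ <-]|z lbz].
  by apply: ovs_scale_ge0; rewrite ?invr_ge0 ?ler0n.
apply: (aX z e) => -[|n]; first by rewrite mulr0n.
have /(ovs_leZ _ _ _ (ler0n R n.+1)) : z <= n.+1%:R^-1 *: e.
  by apply: lbz; exists (n, i0).
by rewrite scalerA mulfV ?pnatr_eq0// scale1r scaler_nat.
Qed.

End OrderedVectorSpaceTheory.

Theorem theorem2p1 (R : realType) (X Y : ovsType R)
    (T : set {linear X -> Y}) :
  archimedean X -> generating_cone X ->
  collectively_o_continuous T -> collectively_order_bounded T.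
Proof.
move=> aX gX cT a b.
(* If [a <= b] fails, the interval is empty and any bounds do; otherwise [a] itself witnesses that
   the index set is inhabited. *)
have [ab|nab] := boolP (a <= b); last first.
  exists 0, 0 => _ [S _ [y yab <-]].
  move: yab; rewrite /= in_itv/= => /andP[ay yb].
  by rewrite (le_trans ay yb) in nab.
(* Dominating both [- a] and [b] places [[a, b]] inside [[- e, e]]. *)
have [e [e0 ae be]] := generating_cone_ub gX (- a) b.
have a_ab : a \in `[a, b] by rewrite in_itv/= lexx.
pose i0 : {y : X | y \in `[a, b]} := exist _ a a_ab.
pose x (p : ranked i0) : X := p.1.+1%:R^-1 *: sval p.2.
have x0 : o_converges x 0.
  exists _, (ranked i0), (fun p => p.1.+1%:R^-1 *: e).
  split; first exact: archimedean_decreases_to0.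
  (* The tail may start at [p] itself: beyond it, [y / (n+1)] lies between [- e / (n+1)] and
     [e / (n+1)], and [e / (n+1) <= e / (p.1+1)]. *)
  move=> p; exists p => -[n [y yab]] pn; rewrite subr0 /x /=.
  have := yab; rewrite in_itv/= => /andP[ay yb].
  have := (archimedean_decreases_to0 i0 aX e0).1 _ _ pn => /= le_e.
  have n0 : 0 <= n.+1%:R^-1 :> R by rewrite invr_ge0 ler0n.
  apply/andP; split; last first.
    by apply: le_trans le_e; apply: ovs_leZ => //; exact: le_trans be.
  rewrite -ovs_leN2 opprK -scalerN; apply: le_trans le_e; apply: ovs_leZ => //.
  by apply: le_trans ae; rewrite ovs_leN2.
have [d [B [g [_ gT]]]] := cT _ _ x x0.
have [β] := @directed_inhabited _ B.
have [[n j] nT] := gT β.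
exists (- (n.+1%:R *: g β)), (n.+1%:R *: g β) => _ [S TS [y yab <-]].
(* The index [(n, y)] has the same rank as [(n, j)], so it lies in the tail whatever [y] is; hence
   [n] and [g β] depend on neither [y] nor [S]. *)
have [] := nT (n, exist _ y yab) (leqnn n) S TS.
rewrite /x /= linearZ/= -scalerN.
move=> /(ovs_leZ _ _ _ (ler0n R n.+1)) + /(ovs_leZ _ _ _ (ler0n R n.+1)).
rewrite !scalerA !mulfV ?pnatr_eq0// !scale1r in_itv/= => -> le_N.
by rewrite andbT -ovs_leN2 opprK.
Qed.
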